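(* If $X$ is a discrete log-concave random variable, then $$N_\infty(X)\ \ge\ 1+\operatorname{Var}(X).$$ Moreover, this bound is asymptotically attained for geometric distributions: if $X_\theta$ ($0<\theta<1$) has probability mass function $p(z)=\theta(1-\theta)^z$, $z\in\{0,1,2,\dots\}$, then $\dfrac{1+\operatorname{Var}(X_\theta)}{N_\infty(X_\theta)}\to 1$ as $\theta\to0$ and as $\theta\to1$.
   Context: A discrete log-concave random variable is an integer-valued random variable $X$ whose probability mass function $p(z)=\mathbb{P}(X=z)$ satisfies $p(z)^2\ge p(z-1)p(z+1)$ for all $z\in\mathbb{Z}$ and whose support $\{z\in\mathbb{Z}:p(z)>0\}$ is contiguous (a set of consecutive integers). The min-entropy is $H_\infty(X)=-\log\max_{z}p(z)$, and $N_\infty(X)=e^{2H_\infty(X)}=\bigl(\max_{z\in\mathbb{Z}}p(z)\bigr)^{-2}$. *)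

(* Defs.v *)
From HB Require Import structures.
From mathcomp Require Import all_boot all_order all_algebra.
From mathcomp Require Import all_classical all_reals all_analysis.
Set Implicit Arguments.
Unset Strict Implicit.
Unset Printing Implicit Defensive.
Import Order.TTheory GRing.Theory Num.Theory.
Import numFieldNormedType.Exports.
Local Open Scope classical_set_scope.
Local Open Scope ring_scope.

Definition integer_valued d (T : measurableType d) (R : realType)
    (P : probability T R) (X : {RV P >-> R}) : Prop :=
  range X `<=` range (intr : int -> R).

Definition int_pmf d (T : measurableType d) (R : realType)
    (P : probability T R) (X : {RV P >-> R}) (z : int) : R :=
  pmf X z%:~R.

Definition contiguous_support (R : realType) (p : int -> R) : Prop :=
  forall a b c : int, a <= b -> b <= c -> 0 < p a -> 0 < p c -> 0 < p b.

Definition discrete_log_concave d (T : measurableType d) (R : realType)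
    (P : probability T R) (X : {RV P >-> R}) : Prop :=
  [/\ integer_valued X,
      forall z : int,
        int_pmf X (z - 1) * int_pmf X (z + 1) <= int_pmf X z ^+ 2
    & contiguous_support (int_pmf X)].

(* The values of a probability mass function are at most 1 and only finitely
   many of them exceed any given positive bound, so for an integer-valued X the
   supremum below is attained: it is the maximum of the mass function. *)
Definition max_pmf d (T : measurableType d) (R : realType)
    (P : probability T R) (X : {RV P >-> R}) : R :=
  sup (range (int_pmf X)).

Definition min_entropy d (T : measurableType d) (R : realType)
    (P : probability T R) (X : {RV P >-> R}) : R :=
  - ln (max_pmf X).

Definition min_entropy_power d (T : measurableType d) (R : realType)
    (P : probability T R) (X : {RV P >-> R}) : R :=
  expR (2 * min_entropy X).

Definition geometric_pmf (R : realType) (theta : R) (z : int) : R :=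
  if z is Posz n then theta * (1 - theta) ^+ n else 0.

Definition has_geometric_distribution d (T : measurableType d) (R : realType)
    (P : probability T R) (X : {RV P >-> R}) (theta : R) : Prop :=
  integer_valued X /\ int_pmf X =1 geometric_pmf theta.

(* Main.v *)
Require Import Defs.
From HB Require Import structures.
From mathcomp Require Import all_boot all_order all_algebra.
From mathcomp Require Import all_classical all_reals all_analysis.
From mathcomp Require Import measurable_realfun zify ring lra.
Import Order.TTheory GRing.Theory Num.Theory.
Import numFieldNormedType.Exports.
Local Open Scope classical_set_scope.
Local Open Scope ring_scope.

(* Fix a point z with M = p(z) > 0 and put g(n) = p(z + n + 1). Log-concavity
   gives M g(i + k + 1) <= g(i) g(k); summing over i and k bounds the binomial
   moments A_j = \sum_n 'C(n, j) g(n) by M A_{j+1} <= A_j A_0, and likewise for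
   the left tail, with equality for geometric tails. The variance is an explicit
   function of these moments, and it increases with A_1 and A_2, so it is at most
   the variance of the two-sided geometric distribution with the same mass at z
   and the same tail masses a and b. With u = a / M and v = b / M, that variance
   is u (1 + u) + v (1 + v) <= (1 + u + v)^2 - 1 = 1 / M^2 - 1. This holds at
   every z, hence for the maximum. *)

(** * Binomial moments of log-concave sequences *)

(** The ratios f(n + 1) / f(n) do not increase, so the i ratios leading from 0 to i have a product
    at least that of the i ratios leading from j to i + j. The second hypothesis rules out internal
    zeros. *)
Lemma log_concave_seq_mul (R : realFieldType) (f : nat -> R) :
  (forall n, 0 <= f n) -> (forall n, f n = 0 -> f n.+1 = 0) ->
  (forall n, f n * f n.+2 <= f n.+1 ^+ 2) ->
  forall i j, f 0%N * f (i + j)%N <= f i * f j.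
Proof.
move=> f_ge0 f_eq0 f_lc.
(* Monotonicity of the ratios, cross-multiplied so that it makes sense at zeros of [f]. *)
have ratio i d : f (i + d).+1 * f i <= f (i + d)%N * f i.+1.
  elim: d => [|d IH]; first by rewrite addn0 mulrC.
  have [f0|f_neq0] := eqVneq (f (i + d.+1)%N) 0.
    by rewrite f_eq0// f0 !mul0r.
  have fd_gt0 : 0 < f (i + d.+1)%N by rewrite lt_def f_neq0 f_ge0.
  rewrite -(ler_pM2r fd_gt0) !addnS.
  have := ler_wpM2l (f_ge0 (i + d).+2) IH.
  have := ler_wpM2r (f_ge0 i.+1) (f_lc (i + d)%N).
  nra.
elim=> [|i IH] j; first by rewrite add0n.
have [f0|f_neq0] := eqVneq (f i) 0.
  have zero k : f (i + k)%N = 0.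
    by elim: k => [|k Hk]; rewrite ?addn0// addnS f_eq0.
  by rewrite addSnnS zero mulr0 mulr_ge0.
have fi_gt0 : 0 < f i by rewrite lt_def f_neq0 f_ge0.
rewrite -(ler_pM2r fi_gt0).
have := ler_wpM2l (f_ge0 0%N) (ratio i j).
have := ler_wpM2r (f_ge0 i.+1) (IH j).
by rewrite addSn; nra.
Qed.

(** The sums over n are factorial moments divided by j!. The binomial basis is chosen because its
    column sums and Pascal's rule give recursions in j. *)
Definition binomial_weight {R : realType} (g : nat -> R) (j n : nat) : R :=
  'C(n, j)%:R * g n.

Lemma binomial_weight0 {R : realType} (g : nat -> R) : binomial_weight g 0 = g.
Proof. by apply/funext => n; rewrite /binomial_weight bin0 mul1r. Qed.

(** The hockey-stick identity. *)
Lemma bin_column_sum (j n : nat) : (\sum_(i < n) 'C(i, j) = 'C(n, j.+1))%N.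
Proof.
by elim: n => [|n IH]; rewrite ?big_ord0 ?bin0n// big_ord_recr IH binS.
Qed.

(** Expand 'C(n, j + 1) as the sum of 'C(i, j) over i < n, exchange the sums, and apply the product
    inequality with n = i + k + 1. *)
Lemma binomial_weight_sum_le {R : realType} (c : R) (g : nat -> R) (j N : nat) :
  (forall n, 0 <= g n) -> (forall i k, c * g (i + k).+1 <= g i * g k) ->
  c * series (binomial_weight g j.+1) N <=
  series (binomial_weight g j) N * series g N.
Proof.
move=> g_ge0 g_lc; rewrite /series /= /binomial_weight.
have -> : \sum_(0 <= n < N) 'C(n, j.+1)%:R * g n =
    \sum_(0 <= i < N) \sum_(0 <= n < N | (i < n)%N) 'C(i, j)%:R * g n.
  rewrite (exchange_big_dep_nat xpredT)//=; apply: eq_big_nat => n /andP[_ nN].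
  rewrite -bin_column_sum natr_sum mulr_suml.
  rewrite -(big_mkord xpredT (fun i => 'C(i, j)%:R * g n)).
  by rewrite (big_nat_widen _ _ N)// ltnW.
rewrite mulr_sumr mulr_suml; apply: ler_sum_nat => i /andP[_ iN].
rewrite -[leRHS]mulrA -mulr_sumr [c * _]mulrCA ler_wpM2l//.
rewrite [X in c * X <= _](_ : _ = \sum_(0 <= k < N - i.+1) g (i + k).+1); last first.
  rewrite -[in LHS](@big_nat_widenl _ _ _ i.+1 0 N xpredT)//.
  rewrite -[in LHS](add0n i.+1) big_addn.
  by apply: eq_bigr => k _; rewrite addnS addnC.
(* Truncation at [N] leaves only k < N - i - 1; the remaining terms on the right are nonnegative. *)
rewrite !mulr_sumr [leRHS](big_cat_nat (n := (N - i.+1)%N)) ?leq_subr//=.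
by rewrite -[leLHS]addr0 lerD ?ler_sum// ?sumr_ge0// => k _; exact: mulr_ge0.
Qed.

Lemma series_nondecreasing {R : realType} (u : nat -> R) :
  (forall n, 0 <= u n) -> nondecreasing_seq (series u).
Proof.
move=> u_ge0; apply/nondecreasing_seqP => n.
by rewrite /series/= big_nat_recr//= lerDl.
Qed.

Lemma binomial_weight_ge0 {R : realType} (g : nat -> R) (j n : nat) :
  (forall n, 0 <= g n) -> 0 <= binomial_weight g j n.
Proof. by move=> g0; rewrite mulr_ge0. Qed.

(** By induction on j: the previous lemma bounds the increasing partial sums of order j + 1 by the
    limits of order j and 0, divided by c. *)
Lemma binomial_weight_cvg {R : realType} (c : R) (g : nat -> R) (j : nat) :
  0 < c -> (forall n, 0 <= g n) ->
  (forall i k, c * g (i + k).+1 <= g i * g k) ->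
  cvgn (series g) -> cvgn (series (binomial_weight g j)).
Proof.
move=> c_gt0 g_ge0 g_lc cg; elim: j => [|j IH]; first by rewrite binomial_weight0.
apply: nondecreasing_is_cvgn.
  by apply: series_nondecreasing => n; exact: binomial_weight_ge0.
exists (limn (series (binomial_weight g j)) * limn (series g) / c) => _ [N _ <-].
rewrite ler_pdivlMr// mulrC (le_trans (binomial_weight_sum_le _ _ _ _ g_ge0 g_lc))//.
have ge0 (u : nat -> R) : (forall n, 0 <= u n) -> 0 <= series u N.
  by move=> u_ge0; rewrite /series/= sumr_ge0.
apply: ler_pM; rewrite ?ge0//; try by move=> n; exact: binomial_weight_ge0.
  apply: nondecreasing_cvgn_le => //.
  by apply: series_nondecreasing => n; exact: binomial_weight_ge0.
by apply: nondecreasing_cvgn_le => //; exact: series_nondecreasing.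
Qed.

Lemma binomial_weight_lim_le {R : realType} (c : R) (g : nat -> R) (j : nat) :
  0 < c -> (forall n, 0 <= g n) ->
  (forall i k, c * g (i + k).+1 <= g i * g k) -> cvgn (series g) ->
  c * limn (series (binomial_weight g j.+1)) <=
  limn (series (binomial_weight g j)) * limn (series g).
Proof.
move=> c_gt0 g_ge0 g_lc cg.
have cw k : cvgn (series (binomial_weight g k)) by exact: (@binomial_weight_cvg _ c).
have cl k : series (binomial_weight g k) @ \oo --> limn (series (binomial_weight g k)).
  exact: cw.
apply: (ler_cvg_to (cvgMl_tmp (a := c) (cl j.+1)) (cvgM (cl j) cg)).
by near=> N; exact: binomial_weight_sum_le.
Unshelve. all: by end_near.
Qed.

(* [a], [x], [y] (resp. [b], [s], [t]) are the binomial moments of order 0, 1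
   and 2 of the two tails; the left-hand side increases with [x], [y], [s], [t]
   up to the two-sided geometric case [x = a ^+ 2 / M], [y = a * x / M]. *)
Lemma tail_moments_bound {R : realFieldType} (M a x y b s t : R) :
  0 < M -> 0 <= a -> 0 <= b -> M + a + b = 1 ->
  M * x <= a ^+ 2 -> M * y <= x * a -> M * s <= b ^+ 2 -> M * t <= s * b ->
  M ^+ 2 * (1 + (a + 3 * x + 2 * y + (b + 3 * s + 2 * t)
    - (a + x - (b + s)) ^+ 2)) <= 1.
Proof.
move=> M_gt0 a_ge0 b_ge0 Mab Mx My Ms Mt.
pose u := a / M; pose v := b / M.
have M_neq0 : M != 0 by rewrite gt_eqF.
have aE : a = u * M by rewrite /u divfK.
have bE : b = v * M by rewrite /v divfK.
have u_ge0 : 0 <= u by rewrite divr_ge0// ltW.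
have v_ge0 : 0 <= v by rewrite divr_ge0// ltW.
have ME : M * (1 + u + v) = 1 by rewrite -[RHS]Mab aE bE; ring.
have M_le1 : M <= 1 by lra.
have Mu w : M * (w * u) = w * a by rewrite aE; ring.
have Mv w : M * (w * v) = w * b by rewrite bE; ring.
have xu : x <= a * u by rewrite -(ler_pM2l M_gt0) Mu -expr2.
have sv : s <= b * v by rewrite -(ler_pM2l M_gt0) Mv -expr2.
have yx : y <= x * u by rewrite -(ler_pM2l M_gt0) Mu.
have ts : t <= s * v by rewrite -(ler_pM2l M_gt0) Mv.
have DE : a + a * u - (b + b * v) = u - v.
  transitivity ((u - v) * (M * (1 + u + v))); last by rewrite ME mulr1.
  by rewrite aE bE; ring.
move: u v => u v in u_ge0 v_ge0 aE bE ME Mu Mv xu sv yx ts DE *.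
have step1 : a + 3 * x + 2 * y + (b + 3 * s + 2 * t) - (a + x - (b + s)) ^+ 2 <=
    a + 3 * (a * u) + 2 * (a * u * u) +
    (b + 3 * (b * v) + 2 * (b * v * v)) - (u - v) ^+ 2.
  (* In terms of the deficits e and h, the right side exceeds the left by at least 3e + 3h + 2ev +
     2hu + (e - h)^2. *)
  have [e xE] : exists e, x = a * u - e by exists (a * u - x); ring.
  have [h sE] : exists h, s = b * v - h by exists (b * v - s); ring.
  have e_ge0 : 0 <= e by lra.
  have h_ge0 : 0 <= h by lra.
  have -> : a + x - (b + s) = u - v - e + h by rewrite -DE xE sE; ring.
  rewrite xE sE in yx ts *.
  have := sqr_ge0 (e - h); have := mulr_ge0 e_ge0 v_ge0.
  have := mulr_ge0 h_ge0 u_ge0.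
  lra.
have step2 : a + 3 * (a * u) + 2 * (a * u * u) +
    (b + 3 * (b * v) + 2 * (b * v * v)) - (u - v) ^+ 2 =
    u * (1 + u) + v * (1 + v).
  (* The two sides agree modulo the relation M(1 + u + v) = 1; the last factor is the cofactor of
     that relation. *)
  transitivity (u * (1 + u) + v * (1 + v) + (M * (1 + u + v) - 1) *
    (u * (1 + 2 * u) + v * (1 + 2 * v) - 2 * u * v)); last first.
    by rewrite ME subrr mul0r addr0.
  by rewrite aE bE; ring.
rewrite step2 in step1.
(* Writing 1 as (M(1 + u + v))^2 leaves 1 + u(1 + u) + v(1 + v) <= (1 + u + v)^2, with gap u + v +
   2uv. *)
rewrite -[leRHS](expr1n _ 2) -[in leRHS]ME exprMn ler_wpM2l ?sqr_ge0//.
by have := mulr_ge0 u_ge0 v_ge0; lra.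
Qed.

(** * Expectations of functions of an integer-valued variable *)

(** Since [Negz n] is -(n + 1), level n pairs the values z + n and z - n - 1; the levels enumerate
    all integers by a single natural index, with both tails side by side. *)
Definition int_level {T : Type} {R : realType} (X : T -> R) (z : int) (n : nat) : set T :=
  X @^-1` [set (z + Posz n)%:~R] `|` X @^-1` [set (z + Negz n)%:~R].

Definition int_level_sum {R : realType} (h : R -> R) (p : int -> R) (z : int)
    (n : nat) : R :=
  h (z + Posz n)%:~R * p (z + Posz n) + h (z + Negz n)%:~R * p (z + Negz n).

Section integer_valued_expectation.
Context {d} {T : measurableType d} {R : realType} {P : probability T R}.
Variables (X : {RV P >-> R}) (z : int).

Lemma measurable_atom (m : int) : measurable (X @^-1` [set m%:~R]).
Proof. exact: measurable_funPTI. Qed.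

Lemma measurable_int_level (n : nat) : measurable (int_level X z n).
Proof. by apply: measurableU; exact: measurable_atom. Qed.

Lemma trivIset_int_level : trivIset setT (int_level X z).
Proof.
move=> m n _ _ [t [Xm Xn]].
have eqX (a b : int) : X t = (z + a)%:~R -> X t = (z + b)%:~R -> a = b.
  by move=> -> /intr_inj/addrI.
by case: Xm => Xm; case: Xn => Xn; case: (eqX _ _ Xm Xn).
Qed.

Lemma bigcup_int_level : integer_valued X -> \bigcup_n int_level X z n = setT.
Proof.
move=> Xint; apply/seteqP; split => // t _.
have [m _ Xm] : range (intr : int -> R) (X t) by apply: Xint; exists t.
have mz : m = z + (m - z) by rewrite addrC subrK.
by case E : (m - z) => [n|n]; rewrite E in mz;
  exists n => //; [left|right]; rewrite /= -Xm mz.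
Qed.

Lemma integral_atom (h : R -> R) (m : int) :
  (\int[P]_(t in X @^-1` [set m%:~R]) (h (X t))%:E)%E =
  (h m%:~R * int_pmf X m)%:E.
Proof.
rewrite (eq_integral (cst (h m%:~R)%:E)); last first.
  by move=> t /[!inE]/= ->.
rewrite integral_cst; last exact: measurable_atom.
by rewrite /int_pmf /pmf EFinM fineK// fin_num_measure//; exact: measurable_atom.
Qed.

Lemma integral_int_level (h : R -> R) (n : nat) : measurable_fun setT h ->
  (\int[P]_(t in int_level X z n) (h (X t))%:E)%E =
  (int_level_sum h (int_pmf X) z n)%:E.
Proof.
move=> mh; rewrite integral_setU ?integral_atom//; try exact: measurable_atom.
  apply: measurable_funS (measurableT) _ _ => //.
  by apply/measurable_EFinP; exact: measurableT_comp.
by apply/disj_setPS => t [/= ->] /intr_inj/addrI.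
Qed.

Lemma ge0_integral_int_levels (h : R -> R) :
  integer_valued X -> measurable_fun setT h -> (forall r, 0 <= h r) ->
  (\int[P]_t (h (X t))%:E = \sum_(n <oo) (int_level_sum h (int_pmf X) z n)%:E)%E.
Proof.
move=> Xint mh h_ge0.
rewrite -bigcup_int_level// ge0_integral_bigcup.
- by apply: eq_eseriesr => n _; exact: integral_int_level.
- exact: measurable_int_level.
- apply: measurable_funS (measurableT) _ _ => //.
  by apply/measurable_EFinP; exact: measurableT_comp.
- by move=> t _; rewrite lee_fin.
- exact: trivIset_int_level.
Qed.

(** Serves the first moment, where [h] changes sign: integrability takes the place of
    nonnegativity. *)
Lemma integral_int_levels (h : R -> R) :
  integer_valued X -> measurable_fun setT h ->
  P.-integrable setT (fun t => (h (X t))%:E) ->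
  (\int[P]_t (h (X t))%:E = \sum_(n <oo) (int_level_sum h (int_pmf X) z n)%:E)%E.
Proof.
move=> Xint mh ih; rewrite -bigcup_int_level// integral_bigcup.
- by apply: eq_eseriesr => n _; exact: integral_int_level.
- exact: trivIset_int_level.
- exact: measurable_int_level.
- by rewrite bigcup_int_level.
Qed.

End integer_valued_expectation.

(** * Series of moments and tails of the mass function *)

Lemma nneseries_cvg_EFin {R : realType} (u : nat -> R) (l : R) :
  series u @ \oo --> l -> (\sum_(n <oo) (u n)%:E = l%:E)%E.
Proof.
move=> ul; rewrite -(cvg_lim _ ul)//; rewrite -EFin_lim; last by apply/cvg_ex; exists l.
by congr (limn _); apply/funext => n /=; rewrite /series/= sumEFin.
Qed.

Lemma cvg_series_shift {R : realType} (u : nat -> R) (l : R) :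
  (series u @ \oo --> u 0%N + l) = (series (fun n => u n.+1) @ \oo --> l).
Proof.
have E : (fun n => series u n.+1) = (fun n => u 0%N + series (fun n => u n.+1) n).
  by apply/funext => n; rewrite /series/= big_nat_recl.
rewrite -cvg_shiftS /= E; apply/propext; split => H.
  rewrite -[l](addKr (u 0%N)).
  rewrite (_ : series _ = fun n => - u 0%N + (u 0%N + series (fun n => u n.+1) n)).
    by apply: cvgD => //; exact: cvg_cst.
  by apply/funext => n; rewrite addKr.
by apply: cvgD => //; exact: cvg_cst.
Qed.

Lemma cvg_seriesD {R : realType} (u v : nat -> R) (k l : R) :
  series u @ \oo --> k -> series v @ \oo --> l ->
  series (fun n => u n + v n) @ \oo --> k + l.
Proof.
move=> uk vl; rewrite (_ : series _ = fun n => series u n + series v n).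
  exact: cvgD.
by apply/funext => n; rewrite /series/= big_split.
Qed.

Lemma cvg_seriesZ {R : realType} (u : nat -> R) (c l : R) :
  series u @ \oo --> l -> series (fun n => c * u n) @ \oo --> c * l.
Proof.
move=> ul; rewrite (_ : series _ = fun n => c * series u n).
  exact: cvgMl_tmp.
by apply/funext => n; rewrite /series/= mulr_sumr.
Qed.

(** The weight is n + 1 because index n of either tail lies at distance n + 1 from the centre. *)
Lemma cvg_first_moment {R : realType} (g : nat -> R) (a b : R) :
  series (binomial_weight g 0) @ \oo --> a ->
  series (binomial_weight g 1) @ \oo --> b ->
  series (fun n => n.+1%:R * g n) @ \oo --> a + b.
Proof.
move=> ga gb; rewrite (_ : (fun n => _) = fun n =>
    binomial_weight g 0 n + binomial_weight g 1 n); first exact: cvg_seriesD.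
by apply/funext => n; rewrite /binomial_weight bin0 bin1 -natr1; ring.
Qed.

Lemma cvg_second_moment {R : realType} (g : nat -> R) (a b c : R) :
  series (binomial_weight g 0) @ \oo --> a ->
  series (binomial_weight g 1) @ \oo --> b ->
  series (binomial_weight g 2) @ \oo --> c ->
  series (fun n => n.+1%:R ^+ 2 * g n) @ \oo --> a + 3 * b + 2 * c.
Proof.
move=> ga gb gc; rewrite (_ : (fun n => _) = fun n => binomial_weight g 0 n +
    3 * binomial_weight g 1 n + 2 * binomial_weight g 2 n).
  apply: cvg_seriesD; last exact: cvg_seriesZ.
  by apply: cvg_seriesD => //; exact: cvg_seriesZ.
apply/funext => n; rewrite /binomial_weight bin0 bin1.
have -> : n.+1%:R ^+ 2 = 1 + 3 * n%:R + 2 * 'C(n, 2)%:R :> R.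
  elim: n => [|n IH]; first by rewrite bin0n/= !mulr0 !addr0 expr1n.
  by rewrite -natr1 sqrrD IH binS bin1 natrD -!natr1; ring.
by ring.
Qed.

Lemma log_concave_tail_mul {R : realFieldType} (p : int -> R) (z : int) :
  (forall m, 0 <= p m) -> (forall m, p (m - 1) * p (m + 1) <= p m ^+ 2) ->
  (forall a b c : int, a <= b -> b <= c -> 0 < p a -> 0 < p c -> 0 < p b) ->
  0 < p z ->
  forall i k : nat, p z * p (z + Posz (i + k).+2) <=
    p (z + Posz i.+1) * p (z + Posz k.+1).
Proof.
move=> p_ge0 p_lc p_supp pz_gt0 i k.
have := @log_concave_seq_mul _ (fun n => p (z + Posz n)) _ _ _ i.+1 k.+1.
rewrite addr0 addSn addnS; apply=> [n //|n fn0|n].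
  (* Contiguity: a positive value at z + n + 1 would force one at z + n, which lies between it and
     z. *)
  apply/eqP; rewrite eq_le p_ge0 andbT leNgt; apply/negP => fn_gt0.
  suff : 0 < p (z + Posz n) by rewrite fn0 ltxx.
  by apply: p_supp pz_gt0 fn_gt0; lia.
have -> : z + Posz n = z + Posz n.+1 - 1 by lia.
have -> : z + Posz n.+2 = z + Posz n.+1 + 1 by lia.
exact: p_lc.
Qed.

Lemma Lfun2_sqr_lty {d} {T : measurableType d} {R : realType}
    (P : probability T R) (Y : T -> R) :
  measurable_fun setT Y -> (\int[P]_t (Y t ^+ 2)%:E < +oo)%E -> Y \in Lfun P 2%:E.
Proof.
move=> mY Y2; rewrite inE; apply/andP; split; rewrite inE//=.
rewrite /finite_norm unlock /Lnorm poweR_lty//=.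
by under eq_integral do rewrite powR_mulrn ?real_normK ?num_real ?normr_ge0 //.
Qed.

(** * The variance in terms of the tail moments *)

Section variance_of_tails.
Context {d} {T : measurableType d} {R : realType} {P : probability T R}.
Variables (X : {RV P >-> R}) (z : int).
Hypothesis X_int : integer_valued X.

Let p := int_pmf X.
Let gr n := p (z + Posz n.+1).
Let gl n := p (z + Negz n).

Let p_ge0 m : 0 <= p m. Proof. exact: pmf_ge0. Qed.

Lemma int_pmf_mass :
  (\sum_(n <oo) (p (z + Posz n) + p (z + Negz n))%:E = 1)%E.
Proof.
transitivity (\int[P]_t (cst 1 (X t))%:E)%E.
  rewrite (ge0_integral_int_levels X z (cst 1))//.
  by apply: eq_eseriesr => n _; rewrite /int_level_sum /= !mul1r.
by rewrite /= integral_cst//= mul1e probability_setT.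
Qed.

Lemma int_pmf_partial_mass N : series (fun n => p (z + Posz n) + p (z + Negz n)) N <= 1.
Proof.
rewrite -lee_fin -int_pmf_mass /series/= -sumEFin; apply: nneseries_lim_ge => n _ _.
by rewrite lee_fin addr_ge0.
Qed.

Lemma right_tail_cvg : cvgn (series gr).
Proof.
apply: nondecreasing_is_cvgn; first by apply: series_nondecreasing => n; exact: p_ge0.
(* The right tail starts at z + 1, so its first N terms lie in the first N + 1 levels. *)
exists 1 => _ [N _ <-]; apply: le_trans (int_pmf_partial_mass N.+1).
rewrite /series/= [leRHS]big_split/= big_nat_recl//= -[leLHS]addr0.
by apply: lerD; [rewrite lerDr; exact: p_ge0|apply: sumr_ge0 => n _; exact: p_ge0].
Qed.

Lemma left_tail_cvg : cvgn (series gl).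
Proof.
apply: nondecreasing_is_cvgn; first by apply: series_nondecreasing => n; exact: p_ge0.
exists 1 => _ [N _ <-]; apply: le_trans (int_pmf_partial_mass N).
rewrite /series/= [leRHS]big_split/= lerDr; apply: sumr_ge0 => n _; exact: p_ge0.
Qed.

(** The variance is computed for Y = X - z: the tails add up in the second moment and are subtracted
    in the first. *)
Lemma variance_tails {a0 a1 a2 b0 b1 b2 : R} :
  series (binomial_weight gr 0) @ \oo --> a0 ->
  series (binomial_weight gr 1) @ \oo --> a1 ->
  series (binomial_weight gr 2) @ \oo --> a2 ->
  series (binomial_weight gl 0) @ \oo --> b0 ->
  series (binomial_weight gl 1) @ \oo --> b1 ->
  series (binomial_weight gl 2) @ \oo --> b2 ->
  p z + a0 + b0 = 1 /\
  ('V_P[X] = (a0 + 3 * a1 + 2 * a2 + (b0 + 3 * b1 + 2 * b2)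
              - (a0 + a1 - (b0 + b1)) ^+ 2)%:E)%E.
Proof.
move=> ga0 ga1 ga2 gb0 gb1 gb2.
split.
  apply: EFin_inj; rewrite -[RHS]int_pmf_mass; apply/esym/nneseries_cvg_EFin.
  rewrite !binomial_weight0 in ga0 gb0.
  apply: cvg_seriesD => //.
  by have := cvg_series_shift (fun n => p (z + Posz n)) a0; rewrite addr0 => ->.
(* The levels include z itself, whereas [gr] starts at z + 1; a weight vanishing at 0 removes the
   central term. *)
have right_cvg (w : R -> R) (l : R) : w 0 = 0 ->
    series (fun n => w n.+1%:R * gr n) @ \oo --> l ->
    series (fun n => w n%:R * p (z + Posz n)) @ \oo --> l.
  move=> w0 wl; have := cvg_series_shift (fun n => w n%:R * p (z + Posz n)) l.
  by rewrite w0 mul0r add0r => ->.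
pose Y : T -> R := X \- cst z%:~R.
have mY : measurable_fun setT Y by apply: measurable_funB.
have pos_sub n : (z + Posz n)%:~R - z%:~R = n%:R :> R.
  by rewrite intrD addrAC subrr add0r.
have neg_sub n : (z + Negz n)%:~R - z%:~R = - n.+1%:R :> R.
  by rewrite intrD addrAC subrr add0r NegzE mulrNz.
have mh1 : measurable_fun setT (fun x : R => x - z%:~R) by apply: measurable_funB.
have mh2 : measurable_fun setT (fun x : R => (x - z%:~R) ^+ 2).
  exact: measurable_funX.
have EY2 : (\int[P]_t (Y t ^+ 2)%:E =
    (a0 + 3 * a1 + 2 * a2 + (b0 + 3 * b1 + 2 * b2))%:E)%E.
  rewrite (ge0_integral_int_levels X z (fun x => (x - z%:~R) ^+ 2))//; last first.
    by move=> r; exact: sqr_ge0.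
  apply: nneseries_cvg_EFin.
  rewrite /int_level_sum; apply: cvg_seriesD.
    under eq_fun do rewrite pos_sub.
    apply: (right_cvg (fun x => x ^+ 2)); first by rewrite expr0n.
    exact: cvg_second_moment.
  under eq_fun do rewrite neg_sub sqrrN.
  exact: cvg_second_moment.
(* The finite second moment gives the integrability on which the signed sum for the mean relies. *)
have Y2 : Y \in Lfun P 2%:E by apply: Lfun2_sqr_lty => //; rewrite EY2 ltry.
have Y1 : Y \in Lfun P 1.
  by apply: Lfun_subset12 Y2; exact: fin_num_measure.
have EY : (\int[P]_t (Y t)%:E = (a0 + a1 - (b0 + b1))%:E)%E.
  rewrite (integral_int_levels X z (fun x => x - z%:~R))//; last first.
    exact/Lfun1_integrable.
  apply: nneseries_cvg_EFin.
  rewrite /int_level_sum; apply: cvg_seriesD.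
    under eq_fun do rewrite pos_sub.
    apply: (right_cvg id) => //.
    exact: cvg_first_moment.
  under eq_fun do rewrite neg_sub mulNr -mulN1r.
  rewrite -[- (b0 + b1)]mulN1r; apply: cvg_seriesZ.
  exact: cvg_first_moment.
have -> : (X : T -> R) = Y \+ cst z%:~R.
  by apply/funext => t; rewrite /= subrK.
rewrite varianceD_cst_r// varianceE//.
rewrite [in ('E_P[Y])%E]unlock EY.
by rewrite unlock EY2.
Qed.

End variance_of_tails.

(** * The min-entropy power inequality *)

Section min_entropy_power.
Context {d} {T : measurableType d} {R : realType} {P : probability T R}.
Variable X : {RV P >-> R}.

Lemma int_pmf_le1 (m : int) : int_pmf X m <= 1.
Proof.
rewrite -lee_fin /int_pmf /pmf fineK ?probability_le1//.
by rewrite fin_num_measure//; exact: measurable_atom.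
Qed.

Lemma int_pmf_le_max (m : int) : int_pmf X m <= max_pmf X.
Proof.
by apply: ub_le_sup; [exists 1 => _ [k _ <-]; exact: int_pmf_le1|exists m].
Qed.

Lemma max_pmf_le (c : R) : (forall m, int_pmf X m <= c) -> max_pmf X <= c.
Proof.
by move=> p_le; apply: ge_sup; [exists (int_pmf X 0), 0|move=> _ [m _ <-]].
Qed.

Lemma int_pmf_gt0_ex : integer_valued X -> exists z, 0 < int_pmf X z.
Proof.
move=> X_int; apply: contrapT => p_le0.
have p0 z : int_pmf X z = 0.
  apply/eqP; rewrite eq_le [X in _ && X]pmf_ge0 andbT leNgt.
  by apply/negP => pz; apply: p_le0; exists z.
have /eqP := int_pmf_mass X 0 X_int.
rewrite eseries0 ?eqe ?oner_eq0//; last by move=> n _ _; rewrite !p0 addr0.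
by rewrite eq_sym oner_eq0.
Qed.

Lemma min_entropy_powerE : 0 < max_pmf X ->
  min_entropy_power X = (max_pmf X ^+ 2)^-1.
Proof.
move=> max_gt0.
by rewrite /min_entropy_power /min_entropy mulrN expRN mulr_natl -lnXn//
  lnK// posrE exprn_gt0.
Qed.

(** Includes finiteness of the variance. It is stated at every point of positive mass so that it
    passes to the supremum. *)
Lemma log_concave_pmf_sqr_variance_le (z : int) :
  discrete_log_concave X -> 0 < int_pmf X z ->
  exists2 v : R, 'V_P[X] = v%:E & int_pmf X z ^+ 2 * (1 + v) <= 1.
Proof.
move=> [X_int p_lc p_supp] M_gt0.
have p_ge0 m : 0 <= int_pmf X m by exact: pmf_ge0.
pose gr n := int_pmf X (z + Posz n.+1).
pose gl n := int_pmf X (z + Negz n).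
have gr_lc := log_concave_tail_mul _ z p_ge0 p_lc p_supp M_gt0.
(* The left tail at z is the right tail at -z of the reflected mass function, which is again
   log-concave with contiguous support. *)
have gl_lc i k : int_pmf X z * gl (i + k).+1 <= gl i * gl k.
  have := log_concave_tail_mul (fun m => int_pmf X (- m)) (- z).
  rewrite opprK /gl !NegzE => /(_ _ _ _ M_gt0 i k).
  rewrite !opprD !opprK; apply=> // [m|a b c ab bc ap cp].
    have -> : - (m - 1) = - m + 1 by lia.
    have -> : - (m + 1) = - m - 1 by lia.
    by rewrite mulrC.
  by apply: p_supp cp ap; rewrite lerN2.
have cr := right_tail_cvg X z X_int.
have cl := left_tail_cvg X z X_int.
have crj j := binomial_weight_cvg _ gr j M_gt0 (fun n => p_ge0 _) gr_lc cr.
have clj j := binomial_weight_cvg _ gl j M_gt0 (fun n => p_ge0 _) gl_lc cl.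
have rj j := binomial_weight_lim_le _ gr j M_gt0 (fun n => p_ge0 _) gr_lc cr.
have lj j := binomial_weight_lim_le _ gl j M_gt0 (fun n => p_ge0 _) gl_lc cl.
have [mass ->] := variance_tails X z X_int
  (crj 0%N) (crj 1%N) (crj 2%N) (clj 0%N) (clj 1%N) (clj 2%N).
have lim_ge0 (g : nat -> R) : (forall n, 0 <= g n) -> cvgn (series g) ->
    0 <= limn (series g).
  by move=> g0 cg; apply: limr_ge => //; apply: nearW => n; exact: sumr_ge0.
eexists; first by reflexivity.
have := (rj 0%N, rj 1%N, lj 0%N, lj 1%N).
rewrite !binomial_weight0 in mass *; case=> -[[r0 r1] l0] l1.
apply: tail_moments_bound => //.
- by apply: lim_ge0 cr => n; exact: p_ge0.
- by apply: lim_ge0 cl => n; exact: p_ge0.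
Qed.

End min_entropy_power.

Lemma one_add_variance_le_min_entropy_power {d} {T : measurableType d}
    {R : realType} {P : probability T R} (X : {RV P >-> R}) :
  discrete_log_concave X -> (1 + 'V_P[X] <= (min_entropy_power X)%:E)%E.
Proof.
move=> X_lc; have [X_int _ _] := X_lc.
have [z z_gt0] := int_pmf_gt0_ex X X_int.
have [v Vv _] := log_concave_pmf_sqr_variance_le X z X_lc z_gt0.
have v_ge0 : 0 <= v by rewrite -lee_fin -Vv variance_ge0.
have max_gt0 : 0 < max_pmf X by apply: lt_le_trans z_gt0 (int_pmf_le_max X z).
have v1_gt0 : 0 < 1 + v by rewrite ltr_pwDl.
rewrite Vv min_entropy_powerE// -EFinD lee_fin.
rewrite -[leLHS]invrK lef_pV2 ?posrE ?exprn_gt0 ?invr_gt0//.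
(* A supremum is bounded mass by mass, so the inequality between squares is replaced by one between
   the masses and a square root. *)
suff : max_pmf X <= Num.sqrt (1 + v)^-1.
  move=> le_sqrt; rewrite -ler_sqrt ?invr_ge0 ?(ltW v1_gt0)//.
  by rewrite sqrtr_sqr ger0_norm// ltW.
apply: max_pmf_le => m; have [p_le0|p_gt0] := lerP (int_pmf X m) 0.
  exact: le_trans p_le0 (sqrtr_ge0 _).
have [w] := log_concave_pmf_sqr_variance_le X m X_lc p_gt0.
rewrite Vv => -[<-] pv.
rewrite -[leLHS]ger0_norm ?(ltW p_gt0)// -sqrtr_sqr ler_sqrt ?invr_ge0 ?(ltW v1_gt0)//.
by rewrite -[leRHS]div1r ler_pdivlMr.
Qed.

(** * Geometric distributions *)

(** Shifting the index by one, Pascal's rule and g(n + 1) = r g(n) give L = r(L + K) for the moments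
    L and K of orders j + 1 and j. *)
Lemma binomial_weight_geometric_lim {R : realType} (r : R) (g : nat -> R) (j : nat) :
  (forall n, g n.+1 = r * g n) ->
  (forall k, cvgn (series (binomial_weight g k))) ->
  (1 - r) * limn (series (binomial_weight g j.+1)) =
  r * limn (series (binomial_weight g j)).
Proof.
move=> gS cg; set L := limn _; set K := limn _.
suff : L = r * (L + K) by move=> LE; rewrite mulrBl mul1r {1}LE; ring.
apply: (@cvg_lim _ _ _ _ _ (series (binomial_weight g j.+1))) => //.
rewrite -[X in _ --> X](add0r) -[0](_ : binomial_weight g j.+1 0 = 0); last first.
  by rewrite /binomial_weight bin0n mul0r.
rewrite cvg_series_shift.
rewrite (_ : (fun n => _) = fun n =>
    r * (binomial_weight g j.+1 n + binomial_weight g j n)).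
  by apply: cvg_seriesZ; apply: cvg_seriesD; exact: cg.
by apply/funext => n; rewrite /binomial_weight gS binS natrD; ring.
Qed.

Section geometric.
Context {d} {T : measurableType d} {R : realType} {P : probability T R}.
Variables (X : {RV P >-> R}) (theta : R).
Hypotheses (theta01 : 0 < theta < 1) (X_geo : has_geometric_distribution X theta).

(** The tail formula centred at 0: the left tail vanishes, the total mass gives the right moment of
    order 0, and the recursion gives orders 1 and 2. *)
Lemma variance_geometric : 'V_P[X] = ((1 - theta) / theta ^+ 2)%:E.
Proof.
have [X_int Xp] := X_geo; have /andP[t_gt0 t_lt1] := theta01.
have r_ge0 : 0 <= 1 - theta by lra.
pose gr n := int_pmf X (0 + Posz n.+1).
pose gl n := int_pmf X (0 + Negz n).
have grE n : gr n = theta * (1 - theta) ^+ n.+1 by rewrite /gr Xp.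
have glE n : gl n = 0 by rewrite /gl Xp.
have gr_ge0 n : 0 <= gr n by rewrite grE mulr_ge0 ?exprn_ge0// ltW.
have gr_mul i k : theta * gr (i + k).+1 <= gr i * gr k.
  by rewrite !grE -addSn -addnS exprD; lra.
have cr := right_tail_cvg X 0 X_int.
have crj j := binomial_weight_cvg _ gr j t_gt0 gr_ge0 gr_mul cr.
have clj j : series (binomial_weight gl j) @ \oo --> (0 : R).
  rewrite (_ : series _ = cst 0); first exact: cvg_cst.
  apply/funext => n; rewrite /series/= big1// => i _.
  by rewrite /binomial_weight glE mulr0.
have grS n : gr n.+1 = (1 - theta) * gr n by rewrite !grE [in LHS]exprS; ring.
have L1 := binomial_weight_geometric_lim _ gr 0 grS crj.
have L2 := binomial_weight_geometric_lim _ gr 1 grS crj.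
have p0 : int_pmf X 0 = theta by rewrite Xp/= expr0 mulr1.
have [mass ->] := variance_tails X 0 X_int
  (crj 0%N) (crj 1%N) (crj 2%N) (clj 0%N) (clj 1%N) (clj 2%N).
move: mass L1 L2; rewrite -/gr p0.
set a := limn _; set b := limn _; set c := limn _ => mass L1 L2.
have t_neq0 : theta != 0 by rewrite gt_eqF.
have aE : a = 1 - theta by lra.
rewrite aE in L1.
have bE : b = (1 - theta) ^+ 2 / theta.
  by apply: (mulfI t_neq0); rewrite mulrCA divff// mulr1; lra.
have cE : c = (1 - theta) ^+ 3 / theta ^+ 2.
  apply: (mulfI t_neq0); rewrite (_ : theta * c = (1 - theta) * b); last by lra.
  by rewrite bE; field.
by congr EFin; rewrite aE bE cE; field.
Qed.

Lemma max_pmf_geometric : max_pmf X = theta.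
Proof.
have [_ Xp] := X_geo; have /andP[t_gt0 t_lt1] := theta01.
apply/eqP; rewrite eq_le; apply/andP; split.
  apply: max_pmf_le => -[n|n]; rewrite Xp /=; last exact: ltW.
  rewrite ler_piMr ?(ltW t_gt0)// exprn_ile1//; lra.
by have := int_pmf_le_max X 0; rewrite Xp/= expr0 mulr1.
Qed.

Lemma geometric_ratio :
  ((1 + 'V_P[X]) / (min_entropy_power X)%:E)%E = (1 - theta + theta ^+ 2)%:E.
Proof.
have /andP[t_gt0 t_lt1] := theta01.
have t_neq0 : theta != 0 by rewrite gt_eqF.
rewrite variance_geometric min_entropy_powerE max_pmf_geometric// inver.
rewrite invr_eq0 expf_eq0/= (negbTE t_neq0) -EFinD -EFinM; congr EFin.
by field.
Qed.

End geometric.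

(** The polynomial equals 1 at both 0 and 1; a general filter covers the two one-sided limits. *)
Lemma geometric_ratio_cvg {R : realType} (F : set_system R) (a : R) :
  Filter F -> F --> a -> 1 - a + a ^+ 2 = 1 ->
  (1 - theta + theta ^+ 2)%:E @[theta --> F] --> 1%:E.
Proof.
move=> FF Fa {2}<-; apply: cvg_EFin; first exact: nearW.
apply: cvgD; first by apply: cvgB => //; exact: cvg_cst.
by apply: cvgM.
Qed.

Theorem theorem1p4 (R : realType) :
  (forall (d : measure_display) (T : measurableType d) (P : probability T R)
      (X : {RV P >-> R}),
    discrete_log_concave X ->
    (1 + 'V_P[X] <= (min_entropy_power X)%:E)%E)
  /\
  (forall (d : R -> measure_display) (T : forall theta, measurableType (d theta))
      (P : forall theta, probability (T theta) R)
      (X : forall theta, {RV (P theta) >-> R}),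
    (forall theta, 0 < theta < 1 ->
      has_geometric_distribution (X theta) theta) ->
    ((1 + 'V_(P theta)[X theta]) / (min_entropy_power (X theta))%:E)%E
      @[theta --> 0^'+] --> 1%:E
    /\
    ((1 + 'V_(P theta)[X theta]) / (min_entropy_power (X theta))%:E)%E
      @[theta --> 1^'-] --> 1%:E).
Proof.
split; first by move=> d T P X; exact: one_add_variance_le_min_entropy_power.
move=> d T P X X_geo; split.
- apply: cvg_trans; last first.
    apply: (@geometric_ratio_cvg _ (0 : R)^'+ 0); last by rewrite expr0n subr0 addr0.
    exact: cvg_at_right_filter.
  (* The law of [X theta] is prescribed only for 0 < theta < 1, which holds eventually along the
     filter. *)
  apply: near_eq_cvg; near=> theta; apply/esym/geometric_ratio; last apply: X_geo.
    by apply/andP; split; near: theta; [exact: nbhs_right_gt|exact: nbhs_right_lt].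
  by apply/andP; split; near: theta; [exact: nbhs_right_gt|exact: nbhs_right_lt].
- apply: cvg_trans; last first.
    apply: (@geometric_ratio_cvg _ (1 : R)^'- 1); last by rewrite expr1n subrr add0r.
    exact: cvg_at_left_filter.
  apply: near_eq_cvg; near=> theta; apply/esym/geometric_ratio; last apply: X_geo.
    by apply/andP; split; near: theta; [exact: nbhs_left_gt|exact: nbhs_left_lt].
  by apply/andP; split; near: theta; [exact: nbhs_left_gt|exact: nbhs_left_lt].
Unshelve. all: by end_near.
Qed.
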